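(* Let $A$ be an associative algebra over a field $K$ and let $r,s\in A\otimes A$, identified with linear maps $r,s:A^*\to A$. (a) $(r,s)$ is an associative Yang-Baxter pair if and only if, for all $a^*,b^*\in A^*$, $$r(a^* )r(b^* )=r(r(a^* )\bullet_\ell b^* )-r(a^*\bullet_r s^t(b^* )),$$ $$s^t(a^* )s^t(b^* )=-s^t(r(a^* )\bullet_\ell b^* )+s^t(a^*\bullet_r s^t(b^* )).$$ (b) If $r$ and $s$ are skew-symmetric, then $(r,s)$ is an associative Yang-Baxter pair if and only if $(A,A^*,r,s)$ is an $\mathcal{O}$-operator system associated to $(A^*,\bullet_\ell,\bullet_r)$.
   Context: All vector spaces, linear maps and tensor products are over a field $K$; associative algebras are not assumed to be unital. $A^*$ is the dual space of $A$, with pairing $\langle f,x\rangle=f(x)$. Elements of $A\otimes A$ are written $r=r^1\otimes r^2$ (implicit summation), and $\bar r,\bar s$ denote further copies of $r,s$. Identification with maps: $r=r^1\otimes r^2\in A\otimes A$ gives linear maps $r,r^t:A^*\to A$, $r(f)=r^1\langle f,r^2\rangle$, $r^t(f)=\langle f,r^1\rangle r^2$ (similarly $s,s^t$). $r$ is skew-symmetric if $r=-r^t$. Dual bimodule $(A^*,\bullet_\ell,\bullet_r)$ of $A$ acting on itself by left and right multiplication: $\langle a\bullet_\ell f,b\rangle=\langle f,ba\rangle$, $\langle f\bullet_r a,b\rangle=\langle f,ab\rangle$ for $a,b\in A$, $f\in A^*$. This is an $A$-bimodule. Associative Yang-Baxter pair: $r,s\in A\otimes A$ with $r_{13}r_{12}-r_{12}r_{23}+s_{23}r_{13}=0$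 and $s_{13}r_{12}-s_{12}s_{23}+s_{23}s_{13}=0$ in $A\otimes A\otimes A$, i.e. $r^1\bar r^1\otimes\bar r^2\otimes r^2-r^1\otimes r^2\bar r^1\otimes\bar r^2+r^1\otimes s^1\otimes s^2r^2=0$, $s^1r^1\otimes r^2\otimes s^2-s^1\otimes s^2\bar s^1\otimes\bar s^2+s^1\otimes\bar s^1\otimes\bar s^2s^2=0$. $\mathcal{O}$-operator system: for an $A$-bimodule $(M,\triangleright,\triangleleft)$ and linear maps $R,S:M\to A$, $(A,M,R,S)$ is an $\mathcal{O}$-operator system associated to $(M,\triangleright,\triangleleft)$ if for all $x,y\in M$: $R(x)R(y)=R(R(x)\triangleright y+x\triangleleft S(y))$ and $S(x)S(y)=S(R(x)\triangleright y+x\triangleleft S(y))$. *)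

(* Defs.v *)
From HB Require Import structures.
From mathcomp Require Import all_boot all_order all_algebra.
From mathcomp Require Import generic_quotient sesquilinear boolp.
Set Implicit Arguments.
Unset Strict Implicit.
Unset Printing Implicit Defensive.
Import GRing.Theory.
Local Open Scope ring_scope.
Local Open Scope quotient_scope.

Notation is_bilinear f := (bilinear_for *:%R *:%R f).

(* MathComp's own algebras are unital. *)
HB.mixin Record isAssocAlgebra (K : fieldType) A of GRing.Lmodule K A := {
  amul : A -> A -> A;
  amulA : associative amul;
  amul_bilinear : is_bilinear amul
}.

#[short(type="assocAlgType")]
HB.structure Definition AssocAlgebra (K : fieldType) :=
  {A of isAssocAlgebra K A & GRing.Lmodule K A}.

Notation "x ⋅ y" := (amul x y) (at level 40, left associativity) : ring_scope.

Section DualSpace.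
Variables (K : fieldType) (V : lmodType K).

Definition dual : Type := {scalar V}.
Definition pairing (f : dual) : {scalar V} := f.
Arguments pairing : simpl never.

HB.instance Definition _ := gen_eqMixin dual.
HB.instance Definition _ := gen_choiceMixin dual.

Implicit Types f g : dual.

Lemma dualP f g : (forall x, pairing f x = pairing g x) -> f = g.
Proof.
case: f g => [f [[fa] [fm]]] [g [[ga] [gm]]] /= /funext fg.
rewrite /pairing /= in fg; rewrite fg in fa fm *.
by rewrite (Prop_irrelevance fa ga) (Prop_irrelevance fm gm).
Qed.

Definition mk_dual (h : V -> K) (hl : linear_for *%R h) : dual :=
  HB.pack_for {scalar V} h (GRing.isLinear.Build K V K *%R h hl).

Lemma mk_dualE h (hl : linear_for *%R h) x : pairing (mk_dual hl) x = h x.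
Proof. by []. Qed.

Fact dual_zero_subproof : linear_for *%R (fun _ : V => 0 : K).
Proof. by move=> a x y; rewrite mulr0 addr0. Qed.
Definition dual_zero := mk_dual dual_zero_subproof.

Fact dual_opp_subproof f : linear_for *%R (fun x => - pairing f x).
Proof. by move=> a x y; rewrite linearP opprD mulrN. Qed.
Definition dual_opp f := mk_dual (dual_opp_subproof f).

Fact dual_add_subproof f g :
  linear_for *%R (fun x => pairing f x + pairing g x).
Proof. by move=> a x y; rewrite !linearP mulrDr addrACA. Qed.
Definition dual_add f g := mk_dual (dual_add_subproof f g).

Fact dual_scale_subproof (c : K) f :
  linear_for *%R (fun x => c * pairing f x).
Proof. by move=> a x y; rewrite linearP mulrDr mulrCA. Qed.
Definition dual_scale c f := mk_dual (dual_scale_subproof c f).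

Fact dual_addA : associative dual_add.
Proof. by move=> f g h; apply: dualP => x; apply: addrA. Qed.
Fact dual_addC : commutative dual_add.
Proof. by move=> f g; apply: dualP => x; apply: addrC. Qed.
Fact dual_add0 : left_id dual_zero dual_add.
Proof. by move=> f; apply: dualP => x; apply: add0r. Qed.
Fact dual_addN : left_inverse dual_zero dual_opp dual_add.
Proof. by move=> f; apply: dualP => x; apply: addNr. Qed.

HB.instance Definition _ :=
  GRing.isZmodule.Build dual dual_addA dual_addC dual_add0 dual_addN.

Fact dual_scaleA a b f :
  dual_scale a (dual_scale b f) = dual_scale (a * b) f.
Proof. by apply: dualP => x; apply: mulrA. Qed.
Fact dual_scale1 : left_id 1 dual_scale.
Proof. by move=> f; apply: dualP => x; apply: mul1r. Qed.
Fact dual_scaleDr : right_distributive dual_scale +%R.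
Proof. by move=> a f g; apply: dualP => x; apply: mulrDr. Qed.
Fact dual_scaleDl f : {morph dual_scale^~ f : a b / a + b}.
Proof. by move=> a b; apply: dualP => x; apply: mulrDl. Qed.

HB.instance Definition _ := GRing.Zmodule_isLmodule.Build K dual
  dual_scaleA dual_scale1 dual_scaleDr dual_scaleDl.

Lemma pairingD f g x : pairing (f + g) x = pairing f x + pairing g x.
Proof. by []. Qed.
Lemma pairingN f x : pairing (- f) x = - pairing f x.
Proof. by []. Qed.
Lemma pairingZ c f x : pairing (c *: f) x = c * pairing f x.
Proof. by []. Qed.

End DualSpace.
Arguments pairing {K V} f : simpl never.

Notation "'⟨' f , x '⟩'" := (pairing f x) (at level 0, f, x at level 99)
  : ring_scope.

(* The list [:: (u1, v1); ...; (un, vn)] stands for the formal sum of the     *)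
(* ui ⊗ vi; tens_eq is the smallest congruence turning these formal sums into *)
(* the abelian group presented by the usual tensor product relations          *)
(* (opposites are then given by (- u, v)).                                    *)
Section TensorProduct.
Variables (K : fieldType) (U V : lmodType K).

Inductive tens_eq : seq (U * V) -> seq (U * V) -> Prop :=
| tens_refl s : tens_eq s s
| tens_sym s t : tens_eq s t -> tens_eq t s
| tens_trans s t w : tens_eq s t -> tens_eq t w -> tens_eq s w
| tens_cat s s' t t' :
    tens_eq s s' -> tens_eq t t' -> tens_eq (s ++ t) (s' ++ t')
| tens_catC s t : tens_eq (s ++ t) (t ++ s)
| tens_zero : tens_eq [:: (0, 0)] [::]
| tens_addl u u' v : tens_eq [:: (u + u', v)] [:: (u, v); (u', v)]
| tens_addr u v v' : tens_eq [:: (u, v + v')] [:: (u, v); (u, v')]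
| tens_scale (c : K) u v : tens_eq [:: (c *: u, v)] [:: (u, c *: v)].

Definition tens_rel : rel (seq (U * V)) := fun s t => `[< tens_eq s t >].

Fact tens_rel_refl : reflexive tens_rel.
Proof. by move=> s; apply/asboolP; apply: tens_refl. Qed.
Fact tens_rel_sym : symmetric tens_rel.
Proof.
by move=> s t; apply/asboolP/asboolP => /tens_sym.
Qed.
Fact tens_rel_trans : transitive tens_rel.
Proof.
move=> t s w /asboolP st /asboolP tw; apply/asboolP.
exact: tens_trans st tw.
Qed.

Canonical tens_equiv := EquivRel tens_rel tens_rel_refl tens_rel_sym
  tens_rel_trans.

Definition tensor : Type := {eq_quot tens_equiv}.
HB.instance Definition _ := Choice.on tensor.
HB.instance Definition _ := EqQuotient.on tensor.

Lemma tens_eqP s t : \pi_tensor s = \pi_tensor t <-> tens_eq s t.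
Proof.
split=> [/eqP|H]; first by rewrite eqmodE => /asboolP.
by apply/eqP; rewrite eqmodE; apply/asboolP.
Qed.

Lemma tens_repr s : tens_eq (repr (\pi_tensor s)) s.
Proof. by apply/tens_eqP; rewrite reprK. Qed.

Definition tens (u : U) (v : V) : tensor := \pi_tensor [:: (u, v)].
Definition tens_add (r s : tensor) : tensor := \pi_tensor (repr r ++ repr s).
Definition tens_scl (c : K) (r : tensor) : tensor :=
  \pi_tensor [seq (c *: p.1, p.2) | p <- repr r].

Lemma tens_addE s t :
  tens_add (\pi_tensor s) (\pi_tensor t) = \pi_tensor (s ++ t).
Proof. by apply/tens_eqP; apply: tens_cat; apply: tens_repr. Qed.

Lemma tens_eq_scl c s t : tens_eq s t ->
  tens_eq [seq (c *: p.1, p.2) | p <- s] [seq (c *: p.1, p.2) | p <- t].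
Proof.
elim=> {s t} /=; try by constructor.
- by move=> s t w _ st _; apply: tens_trans.
- by move=> s s' t t' _ ss' _ tt'; rewrite !map_cat; apply: tens_cat.
- by move=> s t; rewrite !map_cat; apply: tens_catC.
- by rewrite scaler0; apply: tens_zero.
- by move=> u u' v; rewrite scalerDr; apply: tens_addl.
- move=> d u v; rewrite scalerA mulrC -scalerA; exact: tens_scale.
Qed.

Lemma tens_sclE c s :
  tens_scl c (\pi_tensor s) = \pi_tensor [seq (c *: p.1, p.2) | p <- s].
Proof. by apply/tens_eqP; apply/tens_eq_scl/tens_repr. Qed.

Lemma tens_eq0l v : tens_eq [:: (0, v)] [::].
Proof.
apply: tens_trans (tens_zero).
by have := tens_scale 0 0 v; rewrite !scale0r.
Qed.

Lemma tens_eqN s : tens_eq ([seq (-1 *: p.1, p.2) | p <- s] ++ s) [::].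
Proof.
elim: s => [|[u v] s IHs] /=; first exact: tens_refl.
apply: (@tens_trans _ ([:: (-1 *: u, v); (u, v)] ++
          ([seq (-1 *: p.1, p.2) | p <- s] ++ s))).
  set m := map _ s; have := tens_cat (tens_refl [:: (-1 *: u, v)])
    (tens_cat (tens_catC m [:: (u, v)]) (tens_refl s)).
  by rewrite -!catA.
rewrite -[X in tens_eq _ X]cats0; apply: tens_cat IHs.
apply: tens_trans (tens_sym (tens_addl _ _ _)) _.
by rewrite scaleN1r addNr; apply: tens_eq0l.
Qed.

Lemma tensW (P : tensor -> Prop) : (forall s, P (\pi_tensor s)) -> forall r, P r.
Proof. by move=> Ps r; rewrite -[r]reprK. Qed.

Fact tens_addA : associative tens_add.
Proof.
apply: tensW => r; apply: tensW => s; apply: tensW => t.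
by rewrite !tens_addE catA.
Qed.
Fact tens_addC : commutative tens_add.
Proof.
apply: tensW => r; apply: tensW => s; rewrite !tens_addE.
exact/tens_eqP/tens_catC.
Qed.
Fact tens_add0 : left_id (\pi_tensor [::]) tens_add.
Proof. by apply: tensW => r; rewrite tens_addE. Qed.
Fact tens_addN : left_inverse (\pi_tensor [::]) (tens_scl (-1)) tens_add.
Proof.
apply: tensW => r; rewrite tens_sclE tens_addE; exact/tens_eqP/tens_eqN.
Qed.

HB.instance Definition _ :=
  GRing.isZmodule.Build tensor tens_addA tens_addC tens_add0 tens_addN.

Lemma tens_piE s : \pi_tensor s = \sum_(p <- s) tens p.1 p.2.
Proof.
elim: s => [|[u v] s IHs]; first by rewrite big_nil.
by rewrite big_cons -IHs; symmetry; apply: tens_addE.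
Qed.

Fact tens_sclA a b r : tens_scl a (tens_scl b r) = tens_scl (a * b) r.
Proof.
move: r; apply: tensW => s; rewrite !tens_sclE -map_comp; congr (\pi _).
by apply: eq_map => p /=; rewrite scalerA.
Qed.
Fact tens_scl1 : left_id 1 tens_scl.
Proof.
apply: tensW => s; rewrite tens_sclE; congr (\pi _).
by rewrite -[RHS]map_id; apply: eq_map => -[u v] /=; rewrite scale1r.
Qed.
Fact tens_sclDr : right_distributive tens_scl +%R.
Proof.
move=> a; apply: tensW => r; apply: tensW => s.
by rewrite [LHS](congr1 _ (tens_addE _ _)) !tens_sclE map_cat -tens_addE.
Qed.

Lemma tensDl u u' v : tens (u + u') v = tens u v + tens u' v.
Proof. by rewrite [RHS]tens_addE; apply/tens_eqP/tens_addl. Qed.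
Lemma tensDr u v v' : tens u (v + v') = tens u v + tens u v'.
Proof. by rewrite [RHS]tens_addE; apply/tens_eqP/tens_addr. Qed.

Fact tens_sclDl r : {morph tens_scl^~ r : a b / a + b}.
Proof.
move=> a b; move: r; apply: tensW => s; rewrite !tens_sclE !tens_piE !big_map.
by rewrite -big_split; apply: eq_bigr => p _ /=; rewrite scalerDl tensDl.
Qed.

HB.instance Definition _ := GRing.Zmodule_isLmodule.Build K tensor
  tens_sclA tens_scl1 tens_sclDr tens_sclDl.

Lemma tensZl c u v : tens (c *: u) v = c *: tens u v.
Proof. by rewrite [RHS]tens_sclE. Qed.
Lemma tensZr c u v : tens u (c *: v) = c *: tens u v.
Proof. by rewrite -tensZl; apply/tens_eqP/tens_sym/tens_scale. Qed.

Lemma tens_bilinear : is_bilinear tens.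
Proof.
by split=> [v | u] a x y /=; rewrite ?tensDl ?tensDr ?tensZl ?tensZr.
Qed.

Lemma tens_ind (P : tensor -> Prop) :
  P 0 -> (forall u v r, P r -> P (tens u v + r)) -> forall r, P r.
Proof.
move=> P0 PS; apply: tensW => s; rewrite tens_piE.
by elim: s => [|p s IHs]; rewrite (big_nil, big_cons) //; apply: PS.
Qed.

(* Implicit summation r = r^1 ⊗ r^2: [tsum r f] is f(r^1, r^2). It does not   *)
(* depend on the chosen decomposition of r, and is linear in r, when f is     *)
(* bilinear (tsum_sum and tsum_is_linear below).                              *)
Definition tsum (W : lmodType K) (r : tensor) (f : U -> V -> W) : W :=
  \sum_(p <- repr r) f p.1 p.2.

Section Universal.
Variables (W : lmodType K) (f : U -> V -> W).
Hypothesis f_bilin : is_bilinear f.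

Lemma tens_eq_sum s t : tens_eq s t ->
  \sum_(p <- s) f p.1 p.2 = \sum_(p <- t) f p.1 p.2.
Proof.
have [fl fr] := f_bilin.
have fDl u u' v : f (u + u') v = f u v + f u' v.
  by have /= := fl v 1 u u'; rewrite !scale1r.
have fDr u v v' : f u (v + v') = f u v + f u v'.
  by have /= := fr u 1 v v'; rewrite !scale1r.
have f0l v : f 0 v = 0.
  by apply: (addrI (f 0 v)); rewrite -fDl !addr0.
have f0r u : f u 0 = 0.
  by apply: (addrI (f u 0)); rewrite -fDr !addr0.
have fZl c u v : f (c *: u) v = c *: f u v.
  by have /= := fl v c u 0; rewrite !addr0 f0l addr0.
have fZr c u v : f u (c *: v) = c *: f u v.
  by have /= := fr u c v 0; rewrite !addr0 f0r addr0.
elim=> {s t} //.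
- by move=> s t w _ -> _ ->.
- by move=> s s' t t' _ ss' _ tt'; rewrite !big_cat /= ss' tt'.
- by move=> s t; rewrite !big_cat /= addrC.
- by rewrite big_seq1 big_nil /= f0l.
- by move=> u u' v; rewrite !big_cons !big_nil !addr0 /= fDl.
- by move=> u v v'; rewrite !big_cons !big_nil !addr0 /= fDr.
- by move=> c u v; rewrite !big_seq1 /= fZl fZr.
Qed.

Lemma tsum_sum (s : seq (U * V)) :
  tsum (\sum_(p <- s) tens p.1 p.2) f = \sum_(p <- s) f p.1 p.2.
Proof. by rewrite -tens_piE; apply/tens_eq_sum/tens_repr. Qed.

Lemma tsum_tens u v : tsum (tens u v) f = f u v.
Proof. by have := tsum_sum [:: (u, v)]; rewrite !big_seq1. Qed.

Lemma tsum_is_linear : linear (fun r => tsum r f).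
Proof.
move=> c; apply: tensW => r; apply: tensW => s.
have [fl fr] := f_bilin.
have -> : c *: \pi_tensor r + \pi_tensor s =
    \pi_tensor ([seq (c *: p.1, p.2) | p <- r] ++ s).
  by rewrite -tens_addE -tens_sclE.
rewrite !tens_piE !tsum_sum big_cat big_map /= scaler_sumr; congr (_ + _).
apply: eq_bigr => p _; have f0 : f 0 p.2 = 0.
  have /= := fl p.2 1 0 0; rewrite !scale1r addr0 => f00.
  by apply: (addrI (f 0 p.2)); rewrite -f00 addr0.
by have /= := fl p.2 c p.1 0; rewrite f0 !addr0.
Qed.

Lemma tsum_unique (h : {linear tensor -> W}) :
  (forall u v, h (tens u v) = f u v) -> forall r, h r = tsum r f.
Proof.
move=> hf; apply: tensW => s; rewrite tens_piE tsum_sum linear_sum.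
by apply: eq_bigr => p _; apply: hf.
Qed.

End Universal.

End TensorProduct.

Lemma tsum_param (K : fieldType) (X Y U V W : lmodType K)
    (F : X -> Y -> U -> V -> W) (t : tensor U V) :
  (forall u v, is_bilinear (fun x y => F x y u v)) ->
  is_bilinear (fun x y => tsum t (F x y)).
Proof.
move=> Fb; split=> [y | x] a u v; rewrite /= /tsum scaler_sumr -big_split;
  apply: eq_bigr => p _.
  exact: (Fb p.1 p.2).1 y a u v.
exact: (Fb p.1 p.2).2 x a u v.
Qed.

Notation "u ⊗ v" := (tens u v) (at level 45, left associativity) : ring_scope.

Section TensorMaps.
Variables (K : fieldType) (V : lmodType K) (r : tensor V V).

Definition tmap (f : dual V) : V := tsum r (fun x y => ⟨f, y⟩ *: x).
Definition tmapt (f : dual V) : V := tsum r (fun x y => ⟨f, x⟩ *: y).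

Fact tmap_is_linear : linear tmap.
Proof.
move=> c f g; rewrite /tmap /tsum scaler_sumr -big_split; apply: eq_bigr => p _.
by rewrite pairingD pairingZ scalerDl scalerA.
Qed.
HB.instance Definition _ :=
  GRing.isLinear.Build K (dual V) V _ tmap tmap_is_linear.

Fact tmapt_is_linear : linear tmapt.
Proof.
move=> c f g; rewrite /tmapt /tsum scaler_sumr -big_split; apply: eq_bigr => p _.
by rewrite pairingD pairingZ scalerDl scalerA.
Qed.
HB.instance Definition _ :=
  GRing.isLinear.Build K (dual V) V _ tmapt tmapt_is_linear.

Definition skew_symmetric : Prop := forall f, tmap f = - tmapt f.

End TensorMaps.

Lemma tmap_tens (K : fieldType) (V : lmodType K) (x y : V) f :
  tmap (x ⊗ y) f = ⟨f, y⟩ *: x.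
Proof.
apply: tsum_tens; split=> [v | u] a p q /=.
  by rewrite scalerDr !scalerA mulrC.
by rewrite linearP scalerDl scalerA.
Qed.

Lemma tmapt_tens (K : fieldType) (V : lmodType K) (x y : V) f :
  tmapt (x ⊗ y) f = ⟨f, x⟩ *: y.
Proof.
apply: tsum_tens; split=> [v | u] a p q /=.
  by rewrite linearP scalerDl scalerA.
by rewrite scalerDr !scalerA mulrC.
Qed.

Section Algebra.
Variables (K : fieldType) (A : assocAlgType K).

Lemma amulPl (c : K) (x y z : A) : (c *: x + y) ⋅ z = c *: (x ⋅ z) + y ⋅ z.
Proof. exact: amul_bilinear.1. Qed.
Lemma amulPr (c : K) (x y z : A) : x ⋅ (c *: y + z) = c *: (x ⋅ y) + x ⋅ z.
Proof. exact: amul_bilinear.2. Qed.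

Record bimodule (M : lmodType K) := Bimodule {
  lact : A -> M -> M;
  ract : M -> A -> M;
  lact_bilinear : is_bilinear lact;
  ract_bilinear : is_bilinear ract;
  lactA : forall a b m, lact a (lact b m) = lact (a ⋅ b) m;
  ractA : forall m a b, ract (ract m a) b = ract m (a ⋅ b);
  lractA : forall a m b, ract (lact a m) b = lact a (ract m b)
}.

Fact dual_lact_subproof (a : A) (f : dual A) :
  linear_for *%R (fun b => ⟨f, b ⋅ a⟩).
Proof. by move=> c x y; rewrite (amul_bilinear.1 a c x y) linearP. Qed.
Definition dual_lact a f : dual A := mk_dual (dual_lact_subproof a f).

Fact dual_ract_subproof (f : dual A) (a : A) :
  linear_for *%R (fun b => ⟨f, a ⋅ b⟩).
Proof. by move=> c x y; rewrite (amul_bilinear.2 a c x y) linearP. Qed.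
Definition dual_ract f a : dual A := mk_dual (dual_ract_subproof f a).

Lemma dual_lactE a f b : ⟨dual_lact a f, b⟩ = ⟨f, b ⋅ a⟩.
Proof. by []. Qed.
Lemma dual_ractE f a b : ⟨dual_ract f a, b⟩ = ⟨f, a ⋅ b⟩.
Proof. by []. Qed.

Fact dual_lact_bilinear : is_bilinear dual_lact.
Proof.
split=> [f | a] c x y; apply: dualP => b.
  by rewrite pairingD pairingZ !dual_lactE (amul_bilinear.2 b c x y) linearP.
by rewrite pairingD pairingZ !dual_lactE pairingD pairingZ.
Qed.
Fact dual_ract_bilinear : is_bilinear dual_ract.
Proof.
split=> [a | f] c x y; apply: dualP => b.
  by rewrite pairingD pairingZ !dual_ractE pairingD pairingZ.
by rewrite pairingD pairingZ !dual_ractE (amul_bilinear.1 b c x y) linearP.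
Qed.
Fact dual_lactA a b f : dual_lact a (dual_lact b f) = dual_lact (a ⋅ b) f.
Proof. by apply: dualP => x; rewrite !dual_lactE amulA. Qed.
Fact dual_ractA f a b : dual_ract (dual_ract f a) b = dual_ract f (a ⋅ b).
Proof. by apply: dualP => x; rewrite !dual_ractE amulA. Qed.
Fact dual_lractA a f b :
  dual_ract (dual_lact a f) b = dual_lact a (dual_ract f b).
Proof.
by apply: dualP => x; rewrite dual_ractE !dual_lactE dual_ractE amulA.
Qed.

Definition dual_bimodule : bimodule (dual A) :=
  Bimodule dual_lact_bilinear dual_ract_bilinear
    dual_lactA dual_ractA dual_lractA.

Definition O_operator_system (M : lmodType K) (B : bimodule M)
    (R S : {linear M -> A}) : Prop :=
  forall x y : M,
    R x ⋅ R y = R (lact B (R x) y + ract B x (S y)) /\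
    S x ⋅ S y = S (lact B (R x) y + ract B x (S y)).

Definition tensor3 : lmodType K := tensor (tensor A A) A.

(* t_13 w_12, t_12 w_23 and t_23 w_13, written componentwise since A need not *)
(* have a unit.                                                               *)
Definition mul1312 (t w : tensor A A) : tensor3 :=
  tsum t (fun t1 t2 => tsum w (fun w1 w2 => (t1 ⋅ w1) ⊗ w2 ⊗ t2)).
Definition mul1223 (t w : tensor A A) : tensor3 :=
  tsum t (fun t1 t2 => tsum w (fun w1 w2 => t1 ⊗ (t2 ⋅ w1) ⊗ w2)).
Definition mul2313 (t w : tensor A A) : tensor3 :=
  tsum t (fun t1 t2 => tsum w (fun w1 w2 => w1 ⊗ t1 ⊗ (t2 ⋅ w2))).

Lemma mul1312_tens x y z w :
  mul1312 (x ⊗ y) (z ⊗ w) = (x ⋅ z) ⊗ w ⊗ y.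
Proof.
rewrite /mul1312 tsum_tens ?tsum_tens //; last first.
  apply: tsum_param => u v.
  by split=> [b | b] c p q /=; rewrite ?amulPl ?(tensDl, tensDr, tensZl, tensZr).
by split=> [b | b] c p q /=; rewrite ?amulPr ?(tensDl, tensDr, tensZl, tensZr).
Qed.
Lemma mul1223_tens x y z w :
  mul1223 (x ⊗ y) (z ⊗ w) = x ⊗ (y ⋅ z) ⊗ w.
Proof.
rewrite /mul1223 tsum_tens ?tsum_tens //; last first.
  apply: tsum_param => u v.
  by split=> [b | b] c p q /=; rewrite ?amulPl ?(tensDl, tensDr, tensZl, tensZr).
by split=> [b | b] c p q /=; rewrite ?amulPr ?(tensDl, tensDr, tensZl, tensZr).
Qed.
Lemma mul2313_tens x y z w :
  mul2313 (x ⊗ y) (z ⊗ w) = z ⊗ x ⊗ (y ⋅ w).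
Proof.
rewrite /mul2313 tsum_tens ?tsum_tens //; last first.
  apply: tsum_param => u v.
  by split=> [b | b] c p q /=; rewrite ?amulPl ?(tensDl, tensDr, tensZl, tensZr).
by split=> [b | b] c p q /=; rewrite ?amulPr ?(tensDl, tensDr, tensZl, tensZr).
Qed.

Definition assoc_YB_pair (r s : tensor A A) : Prop :=
  mul1312 r r - mul1223 r r + mul2313 s r = 0 /\
  mul1312 s r - mul1223 s s + mul2313 s s = 0.

End Algebra.

Notation "a •ℓ f" := (dual_lact a f) (at level 40) : ring_scope.
Notation "f •r a" := (dual_ract f a) (at level 40) : ring_scope.

(* Main.v *)
Require Import Defs.
From HB Require Import structures.
From mathcomp Require Import all_boot all_order all_algebra.
From mathcomp Require Import boolp classical_sets.
Set Implicit Arguments.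
Unset Strict Implicit.
Unset Printing Implicit Defensive.
Import GRing.Theory.
Local Open Scope ring_scope.

(** An identity in [A ⊗ A ⊗ A] is the same thing as a family of scalar
    identities, obtained by applying [f ⊗ g ⊗ h] for all [f], [g], [h] in the
    dual of [A].  This holds for [A] of any dimension.  Linear functionals
    separate a subspace from a vector outside it (by Zorn's lemma,
    [separating_functional]); hence, by induction on the number of pure tensors
    in an expression of [t], a tensor [t] in [U ⊗ V] vanishes as soon as all
    its contractions [(id ⊗ h) t] do ([contract_eq0]); using this twice gives
    [contract3_eq0].

    The contractions of the three products [t_13 w_12], [t_12 w_23] and
    [t_23 w_13] are expressed through the maps attached to [t] and [w], always as
    a functional evaluated at a product in [A].  Contracting the first
    Yang-Baxter equation by [f ⊗ b ⊗ a] and moving [f] to the outside by the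
    adjunction between [r] and [r^t] gives [f] of the first operator identity at
    [(a, b)]; contracting the second equation by [b ⊗ a ⊗ f] gives [f] of the
    second operator identity at [(a, b)].  As the dual of [A] separates the
    elements of [A], this proves (a).  If [s] is skew-symmetric, replacing [s^t]
    by [- s] turns the two identities into the equations of an O-operator
    system, which is (b). *)

(** * Linear functionals on a vector space of arbitrary dimension *)

Section SeparatingFunctional.
Variables (K : fieldType) (V : lmodType K).
Implicit Types (W : set V) (u v x y : V).

(** Together with [W 0], this says that [W] is a linear subspace. *)
Definition lin_closed W := forall (c : K) x y, W x -> W y -> W (c *: x + y).

Lemma lin_closedZ W c x : W 0 -> lin_closed W -> W x -> W (c *: x).
Proof. by move=> W0 Wl Wx; rewrite -[c *: x]addr0; apply: Wl. Qed.

Lemma lin_closedB W x y : lin_closed W -> W x -> W y -> W (x - y).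
Proof. by move=> Wl Wx Wy; rewrite addrC -scaleN1r; apply: Wl. Qed.

(** [W] is a hyperplane and [V] is the direct sum of [W] and the line of [v];
    the last clause makes [W] nonempty, hence a linear subspace. *)
Definition complements_line v W :=
  lin_closed W /\ ~ W v /\ forall u, exists c : K, W (u - c *: v).

(** A subspace maximal among those that contain [W] but not [v] is a
    hyperplane complementary to the line of [v]. *)
Lemma complement_exists W v : W 0 -> lin_closed W -> ~ W v ->
  exists H : set V, (forall w, W w -> H w) /\ complements_line v H.
Proof.
move=> W0 Wl Wv.
(* Asking that W `|` X, rather than X, be a subspace makes the empty chain
   harmless. *)
pose P (X : set V) := lin_closed (W `|` X)%classic /\ ~ (W `|` X)%classic v.
have [F FP Ftot|H0 [[Hl Hv] Hmax]] := @Zorn_bigcup V P.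
  split=> [c x y|[//|[X FX Xv]]]; last by case: (FP _ FX) => _; apply; right.
  have inF X z : F X -> (W `|` X)%classic z ->
      (W `|` \bigcup_(X in F) X)%classic z.
    by move=> FX [Wz|Xz]; [left|right; exists X].
  have step X : F X -> (W `|` X)%classic x -> (W `|` X)%classic y ->
      (W `|` \bigcup_(X in F) X)%classic (c *: x + y).
    by move=> FX Xx Xy; apply: (inF X _ FX); apply: (FP _ FX).1.
  move=> [Wx|[X FX Xx]] [Wy|[Y FY Yy]].
  - by left; apply: Wl.
  - by apply: (step Y) => //; [left|right].
  - by apply: (step X) => //; [right|left].
  - have [XY|YX] := Ftot _ _ FX FY.
    + by apply: (step Y) => //; right; [apply: XY|].
    + by apply: (step X) => //; right; [|apply: YX].
pose H := (W `|` H0)%classic; exists H; split=> [w|]; first by left.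
split=> //; split=> // u.
have H_0 : H 0 by left.
have [Hu|Hu] := pselect (H u); first by exists 0; rewrite scale0r subr0.
pose B : set V := fun x => exists c y, H y /\ x = c *: u + y.
have HB x : H x -> B x by move=> Hx; exists 0, x; rewrite scale0r add0r.
have WB : (W `|` B)%classic = B by apply: setUidr => x Wx; apply: HB; left.
have Bl : lin_closed B.
  move=> c _ _ [a [x [Hx ->]]] [b [y [Hy ->]]].
  exists (c * a + b), (c *: x + y); split; first exact: Hl.
  by rewrite scalerDl -scalerA scalerDr addrACA.
have H0B : (H0 `<` B)%classic.
  split=> [x H0x|BH0]; first by apply: HB; right.
  by apply/Hu; right; apply: BH0; exists 1, 0; rewrite scale1r addr0.
have [c [y [Hy vE]]] : B v.
  apply: contrapT => Bv; apply: (Hmax B H0B); rewrite /P WB.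
  by split.
have c0 : c != 0.
  by apply/eqP => c0; apply: Hv; move: vE; rewrite c0 scale0r add0r => ->.
exists c^-1; rewrite vE scalerDr scalerA mulVf // scale1r opprD addrA subrr.
by rewrite add0r -scaleNr; apply: lin_closedZ.
Qed.

Lemma separating_functional W v : W 0 -> lin_closed W -> ~ W v ->
  exists f : dual V, ⟨f, v⟩ = 1 /\ forall w, W w -> ⟨f, w⟩ = 0.
Proof.
move=> W0 Wl Wv; have [H [WH [Hl [Hv Hc]]]] := complement_exists W0 Wl Wv.
have H0 : H 0 := WH _ W0.
have coordU u c d : H (u - c *: v) -> H (u - d *: v) -> c = d.
  move=> Hc1 Hd; apply: contrapT => /eqP; rewrite -subr_eq0 => cd.
  apply: Hv; rewrite -[v]scale1r -(mulVf cd) -scalerA.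
  apply: lin_closedZ => //.
  have -> : (c - d) *: v = (u - d *: v) - (u - c *: v).
    by rewrite scalerBl opprB [RHS]addrC addrA subrK.
  exact: lin_closedB.
pose h u := projT1 (cid (Hc u)).
have hP u : H (u - h u *: v) by exact: projT2 (cid (Hc u)).
have hl : linear_for *%R h.
  move=> c x y; apply: (coordU (c *: x + y)) => //.
  rewrite scalerDl -scalerA opprD addrACA -scalerBr.
  exact: Hl.
exists (mk_dual hl); rewrite mk_dualE; split=> [|w Ww].
  by apply: (coordU v) => //; rewrite scale1r subrr.
by rewrite mk_dualE; apply: (coordU w) => //; rewrite scale0r subr0; apply: WH.
Qed.

Lemma dual_separates v : (forall f : dual V, ⟨f, v⟩ = 0) -> v = 0.
Proof.
move=> fv; apply: contrapT => v0.
have [//|c x y -> ->||f [f1 _]] := @separating_functional (fun x => x = 0) v.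
- by rewrite scaler0 addr0.
- exact: v0.
by move: (fv f); rewrite f1 => /eqP; rewrite oner_eq0.
Qed.

End SeparatingFunctional.

(** * Contractions of tensors *)

Section Contraction.
Variables (K : fieldType) (U V : lmodType K).
Implicit Types (h : dual V) (t : tensor U V).

(** [contract h t] is [(id ⊗ h) t]. *)
Definition contract h t : U := tsum t (fun u v => ⟨h, v⟩ *: u).

Fact contract_bilinear h : is_bilinear (fun (u : U) (v : V) => ⟨h, v⟩ *: u).
Proof.
split=> [v | u] a x y /=.
  by rewrite scalerDr !scalerA mulrC.
by rewrite linearP scalerDl scalerA.
Qed.

Fact contract_is_linear h : linear (contract h).
Proof. exact: tsum_is_linear (contract_bilinear h). Qed.

HB.instance Definition _ h :=
  GRing.isLinear.Build K (tensor U V) U _ (contract h) (contract_is_linear h).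

Lemma contract_tens h u v : contract h (u ⊗ v) = ⟨h, v⟩ *: u.
Proof. exact: tsum_tens (contract_bilinear h) u v. Qed.

Let tens0l (v : V) : (0 : U) ⊗ v = 0.
Proof. by rewrite -(scale0r (0 : U)) tensZl scale0r. Qed.

Let tens_sumr n (u : U) (v : 'I_n -> V) :
  u ⊗ (\sum_i v i) = \sum_i (u ⊗ v i).
Proof.
apply: (big_morph (tens u)); first exact: tensDr.
by rewrite -(scale0r (0 : V)) tensZr scale0r.
Qed.

(** Functionals on the right factor suffice to detect the vanishing of a tensor.
    By induction on [n]: [v ord0] is either a combination of the other [v i], and
    then one term can be dispensed with, or else some functional takes the value
    1 on [v ord0] and vanishes on the other [v i], which forces [u ord0] to be
    zero. *)
Lemma sum_tens_eq0 n (u : 'I_n -> U) (v : 'I_n -> V) :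
  (forall h : dual V, \sum_i ⟨h, v i⟩ *: u i = 0) -> \sum_i (u i ⊗ v i) = 0.
Proof.
elim: n => [|n IHn] in u v *; first by rewrite !big_ord0.
move=> hu; pose v' i := v (lift ord0 i); pose u' i := u (lift ord0 i).
pose W : set V := fun x => exists c : 'I_n -> K, x = \sum_i c i *: v' i.
have [[c v0E]|Wv0] := pselect (W (v ord0)).
  have E (f : 'I_n -> K) :
      \sum_i f i *: (u' i + c i *: u ord0)
      = (\sum_i f i * c i) *: u ord0 + \sum_i f i *: u' i.
    rewrite scaler_suml -big_split; apply: eq_bigr => i _ /=.
    by rewrite scalerDr scalerA addrC.
  have -> : \sum_i (u i ⊗ v i) = \sum_i ((u' i + c i *: u ord0) ⊗ v' i).
    rewrite big_ord_recl v0E tens_sumr -big_split; apply: eq_bigr => i _ /=.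
    by rewrite tensDl tensZl tensZr addrC.
  apply: IHn => h; rewrite E -[RHS](hu h) big_ord_recl v0E linear_sum /=.
  congr (_ *: _ + _); apply: eq_bigr => i _.
  by rewrite linearZ /= mulrC.
have W0 : W 0.
  by exists (fun=> 0); rewrite big1 // => i _; rewrite scale0r.
have Wl : lin_closed W.
  move=> c _ _ [a ->] [b ->]; exists (fun i => c * a i + b i).
  rewrite scaler_sumr -big_split; apply: eq_bigr => i _ /=.
  by rewrite scalerDl scalerA.
have [f [f1 fW]] := separating_functional W0 Wl Wv0.
have fv' i : ⟨f, v' i⟩ = 0.
  apply: fW; exists (fun j => (j == i)%:R).
  rewrite (bigD1 i) //= eqxx scale1r big1 ?addr0 // => j /negbTE ->.
  by rewrite scale0r.
have u0 : u ord0 = 0.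
  move: (hu f); rewrite big_ord_recl f1 scale1r big1 ?addr0 // => i _.
  by rewrite (fv' i) scale0r.
rewrite big_ord_recl u0 tens0l add0r; apply: IHn => h.
by move: (hu h); rewrite big_ord_recl u0 scaler0 add0r.
Qed.

Lemma contract_eq0 t : (forall h, contract h t = 0) -> t = 0.
Proof.
elim/tensW: t => s; rewrite tens_piE => hs.
rewrite (big_nth (0, 0)) big_mkord; apply: sum_tens_eq0 => h.
rewrite -[RHS](hs h) (big_nth (0, 0)) big_mkord linear_sum.
by apply: eq_bigr => i _; rewrite /= contract_tens.
Qed.

End Contraction.

Section TripleContraction.
Variables (K : fieldType) (A : assocAlgType K).
Implicit Types (f g h : dual A) (T : tensor3 A) (t w : tensor A A).

(** [contract3 f g h T] is [(f ⊗ g ⊗ h) T]. *)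
Definition contract3 f g h T : K := ⟨f, contract g (contract h T)⟩.

Fact contract3_is_linear f g h : linear_for *%R (contract3 f g h).
Proof. by move=> c x y; rewrite /contract3 !linearP. Qed.

HB.instance Definition _ f g h :=
  GRing.isLinear.Build K (tensor3 A) K _ (contract3 f g h)
    (contract3_is_linear f g h).

Lemma contract3_tens f g h (x y z : A) :
  contract3 f g h (x ⊗ y ⊗ z) = ⟨h, z⟩ * (⟨g, y⟩ * ⟨f, x⟩).
Proof.
by rewrite /contract3 contract_tens linearZ /= contract_tens !linearZ.
Qed.

Lemma contract3_eq0 T : (forall f g h, contract3 f g h T = 0) <-> T = 0.
Proof.
split=> [T0|-> f g h]; last exact: linear0.
apply: contract_eq0 => h; apply: contract_eq0 => g.
by apply: dual_separates => f; apply: T0.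
Qed.

Lemma amulZl (c : K) (x y : A) : (c *: x) ⋅ y = c *: (x ⋅ y).
Proof.
have a0 : 0 ⋅ y = 0.
  by apply: (addrI (0 ⋅ y)); rewrite -[X in X + _]scale1r -amulPl scale1r !addr0.
by have := amulPl c x 0 y; rewrite a0 !addr0.
Qed.

Lemma amulZr (c : K) (x y : A) : x ⋅ (c *: y) = c *: (x ⋅ y).
Proof.
have a0 : x ⋅ 0 = 0.
  by apply: (addrI (x ⋅ 0)); rewrite -[X in X + _]scale1r -amulPr scale1r !addr0.
by have := amulPr c x y 0; rewrite a0 !addr0.
Qed.

Lemma amul_suml I (l : seq I) (F : I -> A) (y : A) :
  (\sum_(i <- l) F i) ⋅ y = \sum_(i <- l) (F i ⋅ y).
Proof.
apply: (big_morph (fun x => x ⋅ y)) => [a b|].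
  by have := amulPl 1 a b y; rewrite !scale1r.
by have := amulZl 0 0 y; rewrite !scale0r.
Qed.

Lemma amul_sumr I (l : seq I) (F : I -> A) (x : A) :
  x ⋅ (\sum_(i <- l) F i) = \sum_(i <- l) (x ⋅ F i).
Proof.
apply: (big_morph (amul x)) => [a b|].
  by have := amulPr 1 x a b; rewrite !scale1r.
by have := amulZr 0 x 0; rewrite !scale0r.
Qed.

Let dual_tmap f t g : ⟨f, tmap t g⟩ = \sum_(p <- repr t) ⟨g, p.2⟩ * ⟨f, p.1⟩.
Proof. by rewrite linear_sum; apply: eq_bigr => p _; rewrite linearZ. Qed.

(** The maps [r] and [r^t] are adjoint to each other. *)
Lemma dual_tmapt f t g : ⟨f, tmapt t g⟩ = ⟨g, tmap t f⟩.
Proof.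
rewrite dual_tmap linear_sum; apply: eq_bigr => p _.
by rewrite linearZ /= mulrC.
Qed.

(** In each product, the functional outside the bracket is the one applied to
    the tensor slot where the multiplication of [A] takes place. *)
Lemma contract3_mul1312 f g h t w :
  contract3 f g h (mul1312 t w) = ⟨f, tmap t h ⋅ tmap w g⟩.
Proof.
rewrite /mul1312 /tmap /tsum amul_suml !linear_sum; apply: eq_bigr => p _.
rewrite amul_sumr !linear_sum; apply: eq_bigr => q _ /=.
by rewrite contract3_tens amulZl amulZr !linearZ /=.
Qed.

Lemma contract3_mul1223 f g h t w :
  contract3 f g h (mul1223 t w) = ⟨g, tmapt t f ⋅ tmap w h⟩.
Proof.
rewrite /mul1223 /tmap /tmapt /tsum amul_suml !linear_sum.
apply: eq_bigr => p _.
rewrite amul_sumr !linear_sum; apply: eq_bigr => q _ /=.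
by rewrite contract3_tens amulZl amulZr !linearZ /= mulrA mulrC.
Qed.

Lemma contract3_mul2313 f g h t w :
  contract3 f g h (mul2313 t w) = ⟨h, tmapt t g ⋅ tmapt w f⟩.
Proof.
rewrite /mul2313 /tmapt /tsum amul_suml !linear_sum; apply: eq_bigr => p _.
rewrite amul_sumr !linear_sum; apply: eq_bigr => q _ /=.
rewrite contract3_tens amulZl amulZr !linearZ /= mulrCA.
by congr (_ * _); apply: mulrC.
Qed.

End TripleContraction.

(** * Yang-Baxter pairs as operator identities *)

Section YangBaxterOperators.
Variables (K : fieldType) (A : assocAlgType K).
Implicit Types (r s : tensor A A) (a b : dual A).

Let eq_by_dual (x y : A) : (forall f : dual A, ⟨f, x⟩ = ⟨f, y⟩) -> x = y.
Proof.
move=> xy; apply/eqP; rewrite -subr_eq0; apply/eqP; apply: dual_separates => f.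
by rewrite linearB /= xy subrr.
Qed.

Lemma first_YB_operatorE r s :
  mul1312 r r - mul1223 r r + mul2313 s r = 0 <->
  forall a b, tmap r a ⋅ tmap r b
              = tmap r (tmap r a •ℓ b) - tmap r (a •r tmapt s b).
Proof.
have E f a b : contract3 f b a (mul1312 r r - mul1223 r r + mul2313 s r)
    = ⟨f, tmap r a ⋅ tmap r b⟩
      - ⟨f, tmap r (tmap r a •ℓ b) - tmap r (a •r tmapt s b)⟩.
  rewrite linearD linearB /= contract3_mul1312 contract3_mul1223
    contract3_mul2313 linearB opprB /=.
  rewrite -(dual_tmapt (tmap r a •ℓ b)) -(dual_tmapt (a •r tmapt s b)).
  by rewrite dual_lactE dual_ractE addrA addrAC.
split=> [YB a b|op].
  apply: eq_by_dual => f; apply/eqP; rewrite -subr_eq0 -E YB.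
  by rewrite linear0.
by apply/contract3_eq0 => f b a; rewrite E op subrr.
Qed.

Lemma second_YB_operatorE r s :
  mul1312 s r - mul1223 s s + mul2313 s s = 0 <->
  forall a b, tmapt s a ⋅ tmapt s b
              = - tmapt s (tmap r a •ℓ b) + tmapt s (a •r tmapt s b).
Proof.
have E f a b : contract3 b a f (mul1312 s r - mul1223 s s + mul2313 s s)
    = ⟨f, tmapt s a ⋅ tmapt s b⟩
      - ⟨f, - tmapt s (tmap r a •ℓ b) + tmapt s (a •r tmapt s b)⟩.
  rewrite linearD linearB /= contract3_mul1312 contract3_mul1223
    contract3_mul2313 linearD linearN /= !dual_tmapt.
  by rewrite dual_lactE dual_ractE opprD opprK addrC.
split=> [YB a b|op].
  apply: eq_by_dual => f; apply/eqP; rewrite -subr_eq0 -E YB.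
  by rewrite linear0.
by apply/contract3_eq0 => b a f; rewrite E op subrr.
Qed.

End YangBaxterOperators.

Theorem theorem4p1 (K : fieldType) (A : assocAlgType K) (r s : tensor A A) :
  (assoc_YB_pair r s <->
     forall a b : dual A,
       tmap r a ⋅ tmap r b
         = tmap r (tmap r a •ℓ b) - tmap r (a •r tmapt s b) /\
       tmapt s a ⋅ tmapt s b
         = - tmapt s (tmap r a •ℓ b) + tmapt s (a •r tmapt s b)) /\
  (skew_symmetric r -> skew_symmetric s ->
     (assoc_YB_pair r s <->
        O_operator_system (dual_bimodule A) (tmap r) (tmap s))).
Proof.
have operatorsE : assoc_YB_pair r s <->
     forall a b : dual A,
       tmap r a ⋅ tmap r b
         = tmap r (tmap r a •ℓ b) - tmap r (a •r tmapt s b) /\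
       tmapt s a ⋅ tmapt s b
         = - tmapt s (tmap r a •ℓ b) + tmapt s (a •r tmapt s b).
  split=> [[/first_YB_operatorE op1 /second_YB_operatorE op2] //|op].
  by split; [apply/first_YB_operatorE|apply/second_YB_operatorE] => a b;
    have [] := op a b.
split=> // _ skew_s; rewrite operatorsE.
have sE f : tmapt s f = - tmap s f by rewrite skew_s opprK.
have ractN (a : dual A) x : a •r (- x) = - (a •r x).
  by apply: dualP => y; rewrite pairingN !dual_ractE -scaleN1r amulZl linearZ
    /= mulN1r.
have mulNN (x y : A) : (- x) ⋅ (- y) = x ⋅ y.
  by rewrite -!scaleN1r amulZl amulZr scalerA mulrNN mulr1 scale1r.
have opE a b :
    (tmap r a ⋅ tmap r b
       = tmap r (tmap r a •ℓ b) - tmap r (a •r tmapt s b) /\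
     tmapt s a ⋅ tmapt s b
       = - tmapt s (tmap r a •ℓ b) + tmapt s (a •r tmapt s b)) <->
    (tmap r a ⋅ tmap r b = tmap r (tmap r a •ℓ b + a •r tmap s b) /\
     tmap s a ⋅ tmap s b = tmap s (tmap r a •ℓ b + a •r tmap s b)).
  by rewrite !sE mulNN ractN !linearN !linearD /= !opprK.
by split=> op a b; apply/opE; apply: op.
Qed.
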